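(* Let $m>1$ and $n>1$ be integers. Then \[ \det A(P_{m-1}\,\Box\,P_{n-1})= \begin{cases} (-1)^{\frac{(m-1)(n-1)}{2}} & \text{if } \gcd(m,n)=1;\\ 0 & \text{otherwise}, \end{cases} \] \[ \det A(C_{m}\,\Box\,C_{n})= \begin{cases} 4^{\gcd(m,n)} & \text{if } m \text{ and } n \text{ are odd};\\ 0 & \text{otherwise}, \end{cases} \] \[ \det A(P_{m-1}\,\Box\,C_{n})= \begin{cases} m & \text{if } n \text{ is odd and } \gcd(m,n)=1;\\ (-1)^{m-1}m^2 & \text{if } n \text{ is even and } \gcd(m,n/2)=1;\\ 0 & \text{otherwise}. \end{cases} \]
   Context: For a graph $G$, $A(G)$ denotes its adjacency matrix. $P_k$ denotes the path on $k$ vertices and $C_k$ the cycle on $k$ vertices (for $k=2$, $C_2$ is understood with adjacency matrix $\begin{pmatrix}0&2\\2&0\end{pmatrix}$, i.e. the adjacency matrix of $C_k$ has eigenvalues $2\cos(2j\pi/k)$, $1\le j\le k$). The Cartesian product $G_1\,\Box\,G_2$ of graphs $G_1=(V_1,E_1)$ and $G_2=(V_2,E_2)$ has vertex set $V_1\times V_2$, with $(u,v)$ adjacent to $(u',v')$ iff either $v=v'$ and $uu'\in E_1$, or $u=u'$ and $vv'\in E_2$. *)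

(* Defs.v *)
From HB Require Import structures.
From mathcomp Require Import all_boot all_order all_algebra.

Set Implicit Arguments.
Unset Strict Implicit.
Unset Printing Implicit Defensive.

Import GRing.Theory.

(* Graphs carry edge multiplicities, because the cycle on two
   vertices has a double edge: its adjacency matrix is [[0, 2], [2, 0]]. A
   simple graph is one with [mult u v <= 1] and [mult u u = 0]. *)
Record multigraph := Multigraph {
  vertex :> finType;
  mult : vertex -> vertex -> nat;
  mult_sym : forall u v, mult u v = mult v u
}.

(* Indexing the rows by the enumeration of the vertices fixes an ordering; the
   determinant does not depend on it. *)
Definition adjacency (G : multigraph) : 'M[int]_#|G| :=
  (\matrix_(i, j) (mult (enum_val i : G) (enum_val j))%:Z)%R.

Section PathGraph.
Variable k : nat.

Definition path_mult (i j : 'I_k) : nat := (i.+1 == j) || (j.+1 == i).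

Lemma path_mult_sym i j : path_mult i j = path_mult j i.
Proof. by rewrite /path_mult orbC. Qed.

Definition path_graph := Multigraph path_mult_sym.

End PathGraph.

Section CycleGraph.
Variable k : nat.

(* The edges of C_k are the k pairs {i, i + 1 mod k}, counted with multiplicity;
   the two summands overlap only for k <= 2. For k = 2 this is the double
   edge, and for k = 1 the 1 x 1 matrix with entry 2 (the eigenvalues are
   2 cos (2 j pi / k) for every k >= 1). *)
Definition cycle_mult (i j : 'I_k) : nat := (ordS i == j) + (ordS j == i).

Lemma cycle_mult_sym i j : cycle_mult i j = cycle_mult j i.
Proof. by rewrite /cycle_mult addnC. Qed.

Definition cycle_graph := Multigraph cycle_mult_sym.

End CycleGraph.

Section CartesianProduct.
Variables G H : multigraph.

(* For loopless graphs at most one summand is nonzero. *)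
Definition cart_mult (x y : G * H) : nat :=
  (x.2 == y.2) * mult x.1 y.1 + (x.1 == y.1) * mult x.2 y.2.

Lemma cart_mult_sym x y : cart_mult x y = cart_mult y x.
Proof.
rewrite /cart_mult (mult_sym x.1) (mult_sym x.2).
by rewrite (eq_sym x.1) (eq_sym x.2).
Qed.

Definition cart_prod := Multigraph cart_mult_sym.

End CartesianProduct.

(* Main.v *)
(* Both adjacency matrices are diagonalised over the algebraic numbers: with
   [w] a primitive 2n-th root of unity, P_(n-1) has eigenvalues [w^j + w^-j]
   for 0 < j < n, and with [z] a primitive n-th root of unity, C_n has
   eigenvalues [z^j + z^-j] for j < n. The spectrum of a Cartesian product
   consists of the sums of eigenvalues. Multiplying over the second factor gives
   [prod_(0 < j < n) (x + 1/x + w^j + w^-j)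
      = x^(1-n) (1 + x^2 + ... + x^(2n-2))]
   and [prod_(j < n) (x + 1/x + z^j + z^-j) = x^-n (x^n - (-1)^n)^2]. What
   remains is evaluated with [prod_(0 < i < n) (1 + y^i + ... + y^(i(m-1)))],
   for [y] a primitive n-th root of unity: this is
   [prod_(0 < i < n) (y^(im) - 1) / (y^i - 1)], which is 1 when [m] is prime to
   [n] (numerator and denominator are the same product up to order) and 0
   otherwise. *)
Require Import Defs.
From mathcomp Require Import all_boot all_order all_algebra all_field ring zify.
Import GRing.Theory.
Local Open Scope ring_scope.

Set Implicit Arguments.
Unset Strict Implicit.
Unset Printing Implicit Defensive.

(** * Products over roots of unity *)

Section RootsOfUnity.
Variable F : fieldType.
Implicit Types (x y z w : F).

Lemma prod_sub_prim_root n z x : n.-primitive_root z ->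
  \prod_(0 <= i < n) (x - z ^+ i) = x ^+ n - 1.
Proof.
move=> hz; have := congr1 (horner^~ x) (factor_Xn_sub_1 hz).
rewrite horner_prod !hornerE => <-.
by apply: eq_bigr => i _; rewrite !hornerE.
Qed.

Lemma prod_add_prim_root n z x : n.-primitive_root z ->
  \prod_(0 <= i < n) (x + z ^+ i) = x ^+ n - (-1) ^+ n.
Proof.
move=> hz; transitivity (\prod_(0 <= i < n) (- 1 * (- x - z ^+ i))).
  by apply: eq_bigr => i _; ring.
rewrite big_split /= prod_sub_prim_root // big_const_nat subn0 iter_mulr_1.
by rewrite mulrBr -exprMn mulN1r opprK mulr1.
Qed.

Lemma prod_prim_root n z : n.-primitive_root z ->
  \prod_(0 <= i < n) z ^+ i = (-1) ^+ n.-1.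
Proof.
move=> hz; have n_gt0 := prim_order_gt0 hz.
under eq_bigr do rewrite -[z ^+ _]add0r.
rewrite prod_add_prim_root // expr0n -(prednK n_gt0) /= exprS; ring.
Qed.

Lemma prod_sub_prim_root1 n z x : n.-primitive_root z ->
  \prod_(1 <= i < n) (x - z ^+ i) = \sum_(k < n) x ^+ k.
Proof.
move=> hz; have n_gt0 := prim_order_gt0 hz.
(* The factor ['X - 1] is cancelled between polynomials, where it is nonzero; cancelling [x - 1]
   between values would lose [x = 1]. *)
have eqp : \prod_(1 <= i < n) ('X - (z ^+ i)%:P) = \sum_(k < n) 'X^k :> {poly F}.
  have X1 : 'X - 1%:P != 0 :> {poly F} by rewrite polyXsubC_eq0.
  apply: (mulfI X1).
  by rewrite -subrX1 -(factor_Xn_sub_1 hz) (big_ltn n_gt0) expr0.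
have := congr1 (horner^~ x) eqp; rewrite horner_prod horner_sum.
under eq_bigr do rewrite !hornerE.
by move=> ->; apply: eq_bigr => i _; rewrite !hornerE.
Qed.

Lemma prim_root_half n w : (0 < n)%N -> n.*2.-primitive_root w -> w ^+ n = -1.
Proof.
move=> n_gt0 hw; have : (w ^+ n) ^+ 2 == 1.
  by rewrite -exprM muln2 (prim_expr_order hw).
rewrite sqrf_eq1 -(prim_order_dvd hw) => /orP[|/eqP //].
by move/(dvdn_leq n_gt0); lia.
Qed.

Lemma prim_root_neq0 n z : n.-primitive_root z -> z != 0.
Proof.
move=> hz; apply/eqP => z0; have := prim_expr_order hz.
move/eqP; rewrite z0 expr0n gtn_eqF ?(prim_order_gt0 hz) //.
by rewrite eq_sym oner_eq0.
Qed.

(* [x + 1/x + t + 1/t = (x + t) (x + 1/t) / x], and the reflection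
   [i -> n - i] turns the factors [x + w^-i] into [x - w^i], so the numerators
   multiply up to the product of the [x^2 - w^(2i)]. *)
Lemma prod_path_eigenvalues n w x : n.*2.-primitive_root w -> x != 0 ->
  \prod_(1 <= i < n) (x + x^-1 + (w ^+ i + w ^- i)) =
    x ^- n.-1 * \sum_(k < n) (x ^+ 2) ^+ k.
Proof.
move=> hw x0; have w0 := prim_root_neq0 hw.
have n_gt0 : (0 < n)%N by have := prim_order_gt0 hw; rewrite double_gt0.
have wn := prim_root_half n_gt0 hw.
have hy : n.-primitive_root (w ^+ 2).
  by have := exp_prim_root hw 2; rewrite -muln2 gcdnMl mulnK.
rewrite -(prod_sub_prim_root1 _ hy).
transitivity (\prod_(1 <= i < n) (x^-1 * ((x + w ^+ i) * (x + w ^- i)))).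
  apply: eq_bigr => i _; have wi0 : w ^+ i != 0 by rewrite expf_neq0.
  by field; rewrite x0 wi0.
rewrite big_split /= big_const_nat iter_mulr_1 subn1 exprVn; congr (_ * _).
rewrite big_split /= [X in _ * X]big_nat_rev /= -big_split /=.
apply: eq_big_nat => i /andP[i1 ltin].
have -> : (1 + n - i.+1 = n - i)%N by lia.
have -> : w ^- (n - i) = - w ^+ i.
  have wni0 : w ^+ (n - i) != 0 by rewrite expf_neq0.
  apply: (mulIf wni0); rewrite mulVf // mulNr -exprD.
  by rewrite subnKC ?(ltnW ltin) // wn opprK.
by rewrite exprAC; ring.
Qed.

Lemma prim_rootV n z : n.-primitive_root z -> n.-primitive_root z^-1.
Proof.
move=> hz; have n_gt0 := prim_order_gt0 hz; have z0 := prim_root_neq0 hz.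
have -> : z^-1 = z ^+ n.-1.
  by apply: (mulfI z0); rewrite divff // -exprS prednK // prim_expr_order.
by rewrite prim_root_exp_coprime // coprime_sym coprimenP.
Qed.

(** Again [x + 1/x + t + 1/t = (x + t) (x + 1/t) / x]; here [z] and [z^-1] are both primitive, so
    either factor multiplies up to [x^n - (-1)^n]. *)
Lemma prod_cycle_eigenvalues n z x : n.-primitive_root z -> x != 0 ->
  \prod_(0 <= j < n) (x + x^-1 + (z ^+ j + z ^- j)) =
    x ^- n * (x ^+ n - (-1) ^+ n) ^+ 2.
Proof.
move=> hz x0; have z0 := prim_root_neq0 hz.
transitivity (\prod_(0 <= j < n) ((x + z ^+ j) * (x^-1 * (x + (z^-1) ^+ j)))).
  apply: eq_bigr => i _; have zi0 : z ^+ i != 0 by rewrite expf_neq0.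
  by rewrite exprVn; field; rewrite x0 zi0.
rewrite !big_split /= big_const_nat iter_mulr_1 subn0 exprVn.
rewrite !prod_add_prim_root ?prim_rootV //; ring.
Qed.

Lemma prod_geometric_prim_root n m y : n.-primitive_root y ->
  \prod_(1 <= i < n) (\sum_(k < m) (y ^+ i) ^+ k) = (gcdn m n == 1)%:R.
Proof.
move=> hy; have n_gt0 := prim_order_gt0 hy.
have yi1 i : (1 <= i < n)%N -> y ^+ i - 1 != 0.
  move=> /andP[i_gt0 ltin]; rewrite subr_eq0 -(prim_order_dvd hy).
  by apply/negP => /(dvdn_leq i_gt0); lia.
case: eqP => [co_mn | /eqP nco_mn].
  have hym : n.-primitive_root (y ^+ m).
    by have := exp_prim_root hy m; rewrite co_mn divn1.
  have nz : \prod_(1 <= i < n) (1 - y ^+ i) != 0.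
    rewrite prodf_seq_neq0; apply/allP => i; rewrite mem_index_iota => hi.
    by rewrite /= -opprB oppr_eq0 yi1.
  apply: (mulfI nz); rewrite -big_split /= mulr1.
  (* At [x = 1], the products for [y] and for [y ^+ m] are the same geometric sum. *)
  rewrite (prod_sub_prim_root1 _ hy) -(prod_sub_prim_root1 _ hym).
  apply: eq_big_nat => i _; rewrite -opprB mulNr -subrX1 opprB.
  by rewrite exprAC.
have g_gt0 : (0 < gcdn m n)%N by rewrite gcdn_gt0 n_gt0 orbT.
(* At this index [y^i] is not 1 but [y^(im)] is, so the geometric sum vanishes. *)
have hi : (1 <= n %/ gcdn m n < n)%N.
  rewrite divn_gt0 // dvdn_leq ?dvdn_gcdr //=.
  by rewrite ltn_Pdiv //; lia.
apply/eqP; rewrite prodf_seq_eq0; apply/hasP; exists (n %/ gcdn m n)%N.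
  by rewrite mem_index_iota.
rewrite /= -(inj_eq (mulfI (yi1 _ hi))) -subrX1 mulr0 subr_eq0.
rewrite -exprM -(prim_order_dvd hy) -{1}(divnK (dvdn_gcdr m n)).
by rewrite dvdn_mul ?dvdn_gcdl.
Qed.

Lemma prod_periodic (R : comNzRingType) d g (f : nat -> R) :
    (forall i, f (i + d)%N = f i) ->
  \prod_(0 <= i < g * d) f i = (\prod_(0 <= i < d) f i) ^+ g.
Proof.
move=> fd; elim: g => [|g IHg]; first by rewrite mul0n big_geq.
rewrite mulSn (@big_cat_nat _ _ _ d) ?leq_addr //= exprS; congr (_ * _).
rewrite -[X in \prod_(X <= _ < _) _]add0n big_addn addKn -IHg.
by apply: eq_bigr => i _.
Qed.

(** The order of [z ^+ k] is [n %/ gcdn k n], so the range consists of [gcdn k n] full periods. *)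
Lemma prod_exp_prim_root n k z (f : F -> F) : n.-primitive_root z ->
  \prod_(0 <= i < n) f ((z ^+ k) ^+ i) =
    (\prod_(0 <= i < (n %/ gcdn k n)%N) f ((z ^+ k) ^+ i)) ^+ gcdn k n.
Proof.
move=> hz; rewrite -{1}(divnK (dvdn_gcdr k n)) mulnC.
rewrite (@prod_periodic F _ _ (fun i => f ((z ^+ k) ^+ i))) // => i.
by rewrite exprD (prim_expr_order (exp_prim_root hz k)) mulr1.
Qed.

End RootsOfUnity.

(** * Determinants from eigenbases *)

Section Spectrum.
Variable F : fieldType.

(* The columns of [v] form an eigenbasis and [w] is the inverse of [v]; rows and
   columns are indexed by vertices so that products of graphs need no
   renumbering. *)
Definition spectral (G : multigraph) (l : G -> F) :=
  exists v w : G -> G -> F,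
    (forall x y, \sum_z (mult x z)%:R * v z y = v x y * l y) /\
    (forall x y, \sum_z v x z * w z y = (x == y)%:R).

Lemma det_adjacency (G : multigraph) (l : G -> F) :
  spectral l -> (\det (adjacency G))%:~R = \prod_x l x.
Proof.
move=> [v [w [Av vw]]].
pose V := \matrix_(i < #|G|, j < #|G|) v (enum_val i) (enum_val j).
pose W := \matrix_(i < #|G|, j < #|G|) w (enum_val i) (enum_val j).
pose L := \row_(j < #|G|) l (enum_val j).
have VW : V *m W = 1%:M.
  apply/matrixP => i j; rewrite !mxE -(inj_eq enum_val_inj) -vw.
  rewrite (reindex (@enum_val _ G)) /=; last exact/onW_bij/enum_val_bij.
  by apply: eq_bigr => k _; rewrite !mxE.
have AV : map_mx intr (adjacency G) *m V = V *m diag_mx L.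
  apply/matrixP => i j; rewrite mul_mx_diag !mxE -Av.
  rewrite [RHS](reindex (@enum_val _ G)) /=; last exact/onW_bij/enum_val_bij.
  by apply: eq_bigr => k _; rewrite !mxE.
have detV : \det V \is a GRing.unit by have /mulmx1_unit[] := VW.
rewrite -det_map_mx -[LHS](mulrK detV) -det_mulmx AV det_mulmx mulrC mulKr //.
rewrite det_diag [RHS](reindex (@enum_val _ G)) /=; last exact/onW_bij/enum_val_bij.
by apply: eq_bigr => k _; rewrite !mxE.
Qed.

Lemma sum_delta (T : finType) (i : T) (f : T -> F) :
  \sum_t (i == t)%:R * f t = f i.
Proof.
rewrite (bigD1 i) //= eqxx mul1r big1 ?addr0 // => t nti.
by rewrite eq_sym (negPf nti) mul0r.
Qed.

(** Tensor products of eigenvectors form the eigenbasis, and the inverse matrix is the tensor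
    product of the inverses. *)
Lemma spectral_cart_prod (G H : multigraph) (l : G -> F) (l' : H -> F) :
  spectral l -> spectral l' ->
  spectral (fun x : cart_prod G H => l x.1 + l' x.2).
Proof.
move=> [v [w [Av vw]]] [v' [w' [Av' vw']]].
exists (fun x y => v x.1 y.1 * v' x.2 y.2), (fun x y => w x.1 y.1 * w' x.2 y.2).
split=> [] [a b] [c d] /=; last first.
  rewrite -(pair_bigA _ (fun z t => v a z * v' b t * (w z c * w' t d))) /=.
  rewrite xpair_eqE -mulnb natrM -vw -vw' mulr_suml; apply: eq_bigr => z _.
  by rewrite mulr_sumr; apply: eq_bigr => t _; rewrite mulrACA.
rewrite -(pair_bigA _
  (fun z t => (cart_mult (a, b) (z, t))%:R * (v z c * v' t d))) /=.
rewrite /cart_mult /=.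
transitivity (\sum_z (mult a z)%:R * v z c * (\sum_t (b == t)%:R * v' t d)
   + \sum_z (a == z)%:R * v z c * (\sum_t (mult b t)%:R * v' t d)).
  rewrite -big_split; apply: eq_bigr => z _ /=.
  rewrite !mulr_sumr -big_split; apply: eq_bigr => t _ /=.
  by rewrite natrD !natrM; ring.
rewrite -!mulr_suml !sum_delta Av Av'; ring.
Qed.

(** * Eigenbases of paths and cycles *)

Section OrdinalVertices.
Variables (n : nat) (e : 'I_n -> 'I_n -> nat).
Hypothesis e_sym : forall i j, e i j = e j i.
Variables (v : 'I_n -> 'I_n -> F) (l : 'I_n -> F).
Hypothesis Av : forall i j, \sum_k (e i k)%:R * v k j = v i j * l j.
Let V := \matrix_(i, j) v i j.

Lemma spectral_ord : V \in unitmx -> spectral (l : Multigraph e_sym -> F).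
Proof.
move=> Vu; exists v, (invmx V); split=> // x y.
have /matrixP/(_ x y) := mulmxV Vu; rewrite !mxE => <-.
by apply: eq_bigr => z _; rewrite !mxE.
Qed.

End OrdinalVertices.

(* For a row [r] with nonzero entries, the rows [r, r D, r D^2, ...] form a
   Vandermonde matrix in the eigenvalues, up to column scaling; since
   [u A^i V = u V D^i], it factors through [V]. *)
Lemma eigenmatrix_unit n (A V : 'M[F]_n) (l u : 'rV[F]_n) :
    A *m V = V *m diag_mx l -> (forall i j, l 0 i = l 0 j -> i = j) ->
    (forall j, (u *m V) 0 j != 0) -> V \in unitmx.
Proof.
move=> AV l_inj uV.
pose K := \matrix_(i < n) iter i (mulmx^~ A) u.
have rowKV i : iter i (mulmx^~ A) u *m V = \row_j ((u *m V) 0 j * l 0 j ^+ i).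
  elim: i => [|i IHi] /=; first by apply/rowP => j; rewrite mxE mulr1.
  rewrite -mulmxA AV mulmxA IHi; apply/rowP => j.
  by rewrite mul_mx_diag !mxE exprSr mulrA.
have KV : K *m V = Vandermonde n l *m diag_mx (u *m V).
  apply/row_matrixP => i; rewrite row_mul rowK rowKV.
  by apply/rowP => j; rewrite mul_mx_diag !mxE mulrC.
have : K *m V \in unitmx.
  rewrite KV unitmx_mul; apply/andP; split; rewrite unitmxE unitfE.
    rewrite det_Vandermonde; apply/prodf_neq0 => i _; apply/prodf_neq0 => j ltij.
    rewrite subr_eq0; apply: contraTN ltij => /eqP/l_inj ->.
    by rewrite ltnn.
  by rewrite det_diag; apply/prodf_neq0 => j _; exact: uV.
by rewrite unitmx_mul => /andP[].
Qed.

Lemma spectral_path n (w : F) : n.+1.*2.-primitive_root w ->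
  spectral (fun j : path_graph n => w ^+ j.+1 + w ^- j.+1).
Proof.
move=> hw; have w0 := prim_root_neq0 hw.
have wX0 i : w ^+ i != 0 by rewrite expf_neq0.
have wn := prim_root_half (ltn0Sn n) hw.
(* The analogue of [sin (pi i (j + 1) / (n + 1))]. Rows count vertices from 1; rows 0 and [n.+1]
   stand for the missing neighbours of the two ends, and [v] vanishes there. *)
pose v (i j : nat) := w ^+ (i * j.+1) - w ^- (i * j.+1).
have v0 j : v 0 j = 0 by rewrite /v mul0n expr0 invr1 subrr.
have vn j : v n.+1 j = 0.
  rewrite /v exprM wn -signr_odd; case: odd; rewrite ?invrN ?invr1; ring.
have sum_ord i j : (i <= n)%N -> \sum_(k < n) (i == k)%:R * v k.+1 j = v i.+1 j.
  move=> lein; case: (ltngtP i n) lein => // [ltin|->] _.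
    rewrite (bigD1 (Ordinal ltin)) //= eqxx mul1r big1 ?addr0 // => k.
    by rewrite -val_eqE /= eq_sym => /negPf ->; rewrite mul0r.
  by rewrite vn big1 // => k _; rewrite gtn_eqF ?mul0r.
have Av (i j : 'I_n) : \sum_k (path_mult i k)%:R * v k.+1 j =
    v i.+1 j * (w ^+ j.+1 + w ^- j.+1).
  transitivity (v i j + v i.+2 j); last first.
    rewrite /v !mulSn !exprD; field.
    by rewrite !wX0.
  transitivity (\sum_(k < n) (i == k.+1 :> nat)%:R * v k.+1 j
     + \sum_(k < n) (i.+1 == k)%:R * v k.+1 j).
    rewrite -big_split; apply: eq_bigr => k _ /=; rewrite -mulrDl -natrD.
    congr (_%:R * _); rewrite /path_mult eq_sym [in RHS]eq_sym; lia.
  congr (_ + _); last exact: sum_ord.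
  case: i => [[|i] lti] /=; first by rewrite v0 big1 // => k _; rewrite mul0r.
  by under eq_bigr do rewrite eqSS; rewrite sum_ord // ltnW // ltnW.
apply: (@spectral_ord _ _ _ (fun i j => v i.+1 j)) => //.
pose l := \row_(j < n) (w ^+ j.+1 + w ^- j.+1).
(* This [u] picks the first row of the eigenmatrix, with entries [w^(j+1) - w^-(j+1)]; these are
   nonzero because [2(j+1) < 2(n+1)]. *)
pose u := \row_(j < n) ((j == 0 :> nat)%:R : F).
apply: (@eigenmatrix_unit _ (\matrix_(i, j) (path_mult i j)%:R) _ l u).
- apply/matrixP => i j; rewrite mul_mx_diag !mxE -Av.
  by apply: eq_bigr => k _; rewrite !mxE.
- move=> i j; rewrite !mxE => eq_l.
  (* [a + 1/a = b + 1/b] forces [a = b] or [a b = 1]; the exponents are too small for the latter. *)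
  have : (w ^+ i.+1 - w ^+ j.+1) * (w ^+ (i.+1 + j.+1) - 1) = 0.
    transitivity (w ^+ i.+1 * w ^+ j.+1 *
      ((w ^+ i.+1 + w ^- i.+1) - (w ^+ j.+1 + w ^- j.+1))).
      by rewrite exprD; field; rewrite !wX0.
    by rewrite eq_l subrr mulr0.
  move=> /eqP; rewrite mulf_eq0 !subr_eq0 (eq_prim_root_expr hw).
  have := ltn_ord i; have := ltn_ord j => ltj lti.
  rewrite -(prim_order_dvd hw) => /orP[/eqP|/dvdn_leq]; last by lia.
  by rewrite !modn_small; [case=> /val_inj|lia|lia].
move=> j; have n_gt0 : (0 < n)%N by apply: leq_ltn_trans (ltn_ord j).
rewrite mxE (bigD1 (Ordinal n_gt0)) //= big1 => [|k]; last first.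
  by rewrite -val_eqE /= !mxE => /negPf ->; rewrite mul0r.
rewrite !mxE eqxx mul1r addr0 /v mul1n subr_eq0; apply/eqP => eqw.
have : w ^+ (j.+1 + j.+1) == 1 by rewrite exprD {1}eqw mulVf.
by rewrite -(prim_order_dvd hw) => /dvdn_leq; have := ltn_ord j; lia.
Qed.

(** The eigenvectors are the Fourier vectors. Eigenvalues may repeat ([j] and [n - j]), but the
    eigenmatrix is itself Vandermonde in the distinct [z ^+ j]. *)
Lemma spectral_cycle n (z : F) : n.-primitive_root z ->
  spectral (fun j : cycle_graph n => z ^+ j + z ^- j).
Proof.
move=> hz; have z0 := prim_root_neq0 hz.
have zX0 i : z ^+ i != 0 by rewrite expf_neq0.
have z_ordS (i : 'I_n) j : z ^+ (ordS i * j) = z ^+ (i * j) * z ^+ j.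
  by rewrite exprM /= (prim_expr_mod hz) -exprM mulSn exprD mulrC.
apply: (@spectral_ord _ _ _ (fun i j => z ^+ (i * j))) => [i j|].
  transitivity (z ^+ (ordS i * j) + z ^+ (ord_pred i * j)); last first.
    by rewrite z_ordS -[in z ^+ (i * j)](ord_predK i) z_ordS; field; rewrite !zX0.
  rewrite -[z ^+ (ordS i * j)](sum_delta _ (fun k : 'I_n => z ^+ (k * j))).
  rewrite -[z ^+ (ord_pred i * j)](sum_delta _ (fun k : 'I_n => z ^+ (k * j))).
  rewrite -big_split; apply: eq_bigr => k _ /=.
  rewrite -mulrDl -natrD /cycle_mult; congr ((_ + _)%:R * _).
  by rewrite (can2_eq (@ordSK _) (@ord_predK _)) eq_sym.
rewrite (_ : \matrix_(i, j) _ = Vandermonde n (\row_j z ^+ j)); last first.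
  by apply/matrixP => i j; rewrite !mxE -exprM mulnC.
rewrite unitmxE unitfE det_Vandermonde.
apply/prodf_neq0 => i _; apply/prodf_neq0 => j ltij.
rewrite !mxE subr_eq0 (eq_prim_root_expr hz) !modn_small //.
by rewrite gtn_eqF.
Qed.

End Spectrum.

(** * Evaluation of the three double products *)

Section EigenvalueProducts.
Variables (F : fieldType) (m n : nat).

Lemma prod_path_path (w w' : F) :
    m.*2.-primitive_root w -> n.*2.-primitive_root w' ->
  \prod_(1 <= i < m) \prod_(1 <= j < n) (w ^+ i + w ^- i + (w' ^+ j + w' ^- j)) =
    if gcdn m n == 1%N then (-1) ^+ (m.-1 * n.-1)./2 else 0.
Proof.
move=> hw hw'.
have m_gt0 : (0 < m)%N by have := prim_order_gt0 hw; rewrite double_gt0.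
have n_gt0 : (0 < n)%N by have := prim_order_gt0 hw'; rewrite double_gt0.
have hy : m.-primitive_root (w ^+ 2).
  by have := exp_prim_root hw 2; rewrite -muln2 gcdnMl mulnK.
transitivity (\prod_(1 <= i < m)
    (w ^- (i * n.-1) * \sum_(k < n) ((w ^+ 2) ^+ i) ^+ k)).
  apply: eq_bigr => i _.
  rewrite (prod_path_eigenvalues hw') ?expf_neq0 ?(prim_root_neq0 hw) //.
  by rewrite exprM (exprAC w 2).
rewrite big_split /= (prod_geometric_prim_root _ hy) prodfV prodrXr.
rewrite -big_distrl /= gcdnC.
case: eqP => [co_mn|_]; last by rewrite mulr0.
have even_mn : ~~ odd (m.-1 * n.-1).
  apply/negP; rewrite oddM => /andP[om on].
  have : (2 %| gcdn m n)%N by rewrite dvdn_gcd !dvdn2; lia.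
  by rewrite co_mn.
(* The exponent of [1/w] is [m (m-1)/2 * (n-1)]. The half is moved onto [(m-1)(n-1)], even by
   coprimality, leaving a multiple of [m] for [w^m = -1]. *)
have -> : ((\sum_(1 <= i < m) i) * n.-1 = m * (m.-1 * n.-1)./2)%N.
  have := bin2_sum m; rewrite big_ltn // add0n => ->.
  apply: double_inj; have := mul_bin_diag m 1; rewrite bin1 => e.
  rewrite -mul2n mulnA -e doubleMr even_halfK ?mulnA //.
rewrite exprM (prim_root_half m_gt0 hw) mulr1 -exprVn invrN invr1 //.
Qed.

Lemma prod_cycle_cycle (z z' : F) : m.-primitive_root z -> n.-primitive_root z' ->
  \prod_(0 <= i < m) \prod_(0 <= j < n) (z ^+ i + z ^- i + (z' ^+ j + z' ^- j)) =
    if odd m && odd n then 4 ^+ gcdn m n else 0.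
Proof.
move=> hz hz'; have m_gt0 := prim_order_gt0 hz; have n_gt0 := prim_order_gt0 hz'.
transitivity (\prod_(0 <= i < m)
    ((z ^+ i) ^- n * ((z ^+ n) ^+ i - (-1) ^+ n) ^+ 2)).
  apply: eq_bigr => i _.
  by rewrite (prod_cycle_eigenvalues hz') ?expf_neq0 ?(prim_root_neq0 hz) // exprAC.
(* Used with [i = 0] when [n] is even, and with [i = m/2], where [z^i = -1], when [n] is odd and [m]
   even. *)
have vanish i : (i < m)%N -> (z ^+ n) ^+ i = (-1) ^+ n ->
    \prod_(0 <= i < m) ((z ^+ i) ^- n * ((z ^+ n) ^+ i - (-1) ^+ n) ^+ 2) = 0.
  move=> ltim e; apply/eqP; rewrite prodf_seq_eq0; apply/hasP; exists i.
    by rewrite mem_index_iota.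
  by rewrite /= e subrr expr0n mulr0.
case: (boolP (odd n)) => on; last first.
  by rewrite andbF (vanish 0) // -signr_odd (negPf on).
case: (boolP (odd m)) => om /=; last first.
  have hm : (m./2).*2 = m by rewrite even_halfK.
  have m2_gt0 : (0 < m./2)%N by lia.
  rewrite (vanish m./2) //; first by lia.
  by rewrite exprAC (@prim_root_half _ m./2) // hm.
rewrite big_split /= prodfV prodrXl (prod_prim_root hz).
rewrite -signr_odd (_ : odd m.-1 = false) ?expr0 ?expr1n ?invr1 ?mul1r;
  last by lia.
rewrite prodrXl -signr_odd on expr1.
(* Since [z ^+ n] has odd order, [1 + (z^n)^i] multiplies up to [1 - (-1) = 2] over each of the
   [gcdn n m] periods; the square gives the power of 4. *)
rewrite (@prod_exp_prim_root _ _ n z (fun x => x - (-1)) hz).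
under eq_bigr do rewrite opprK addrC.
rewrite (prod_add_prim_root _ (exp_prim_root hz n)) expr1n -signr_odd.
have -> : odd (m %/ gcdn n m).
  by move: om; rewrite -{1}(divnK (dvdn_gcdr n m)) oddM => /andP[].
by rewrite expr1 -exprM mulnC exprM gcdnC; congr (_ ^+ _); ring.
Qed.

Lemma prod_path_cycle (w z : F) : m.*2.-primitive_root w -> n.-primitive_root z ->
  \prod_(1 <= i < m) \prod_(0 <= j < n) (w ^+ i + w ^- i + (z ^+ j + z ^- j)) =
    if odd n && (gcdn m n == 1%N) then m%:R
    else if ~~ odd n && (gcdn m n./2 == 1%N) then (-1) ^+ m.-1 * m%:R ^+ 2
    else 0.
Proof.
move=> hw hz; have n_gt0 := prim_order_gt0 hz.
have m_gt0 : (0 < m)%N by have := prim_order_gt0 hw; rewrite double_gt0.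
(* With the path product innermost, each [j] contributes a geometric sum in [z^(2j)]. *)
rewrite exchange_big /=.
transitivity (\prod_(0 <= j < n)
    ((z ^+ j) ^- m.-1 * \sum_(k < m) ((z ^+ 2) ^+ j) ^+ k)).
  apply: eq_bigr => j _; under eq_bigr do rewrite addrC.
  rewrite (prod_path_eigenvalues hw) ?expf_neq0 ?(prim_root_neq0 hz) //.
  by rewrite (exprAC z 2).
rewrite big_split /= prodfV prodrXl (prod_prim_root hz).
(* One period of [z ^+ 2] gives [m] from [j = 0], times 1 or 0 from the rest. There are one or two
   periods as [n] is odd or even, hence [m] or [m^2]. *)
rewrite (@prod_exp_prim_root _ _ 2 z (fun x => \sum_(k < m) x ^+ k) hz).
have hy := exp_prim_root hz 2; rewrite (big_ltn (prim_order_gt0 hy)).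
rewrite (prod_geometric_prim_root _ hy) expr0.
have -> : \sum_(k < m) 1 ^+ k = m%:R :> F.
  by under eq_bigr do rewrite expr1n; rewrite sumr_const card_ord.
rewrite -signr_odd; case: (boolP (odd n)) => on /=.
  have -> : gcdn 2 n = 1%N by apply/eqP; rewrite -/(coprime 2 n) coprime2n.
  rewrite divn1 expr1 (_ : odd n.-1 = false) ?expr0 ?expr1n ?invr1 ?mul1r;
  last by lia.
  by case: eqP => _; rewrite ?mulr1 ?mulr0.
have -> : gcdn 2 n = 2 by apply/gcdn_idPl; rewrite dvdn2.
rewrite divn2 (_ : odd n.-1 = true); last by lia.
rewrite expr1 -exprVn invrN invr1.
by case: eqP => _; rewrite ?mulr1 ?mulr0 ?expr0n ?mulr0.
Qed.

End EigenvalueProducts.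

(** * Assembly over the algebraic numbers *)

Lemma det_cart_prod (F : fieldType) (G H : multigraph) (l : G -> F) (l' : H -> F) :
  spectral l -> spectral l' ->
  (\det (adjacency (cart_prod G H)))%:~R = \prod_x \prod_y (l x + l' y).
Proof.
move=> hl hl'; rewrite (det_adjacency (spectral_cart_prod hl hl')).
by rewrite [RHS]pair_bigA.
Qed.

Theorem theorem1 (m n : nat) (hm : (1 < m)%N) (hn : (1 < n)%N) :
  [/\ \det (adjacency (cart_prod (path_graph (m - 1)) (path_graph (n - 1)))) =
        (if gcdn m n == 1%N then (-1) ^+ ((m - 1) * (n - 1) %/ 2)%N else 0),
      \det (adjacency (cart_prod (cycle_graph m) (cycle_graph n))) =
        (if odd m && odd n then 4 ^+ gcdn m n else 0)
    & \det (adjacency (cart_prod (path_graph (m - 1)) (cycle_graph n))) =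
        (if odd n && (gcdn m n == 1%N) then m%:R
         else if ~~ odd n && (gcdn m (n %/ 2) == 1%N)
              then (-1) ^+ (m - 1) * m%:R ^+ 2
         else 0) ].
Proof.
rewrite !subn1 !divn2.
have m_gt0 := ltnW hm; have n_gt0 := ltnW hn.
have [|w hw] := @C_prim_root_exists m.*2; first by rewrite double_gt0.
have [|w' hw'] := @C_prim_root_exists n.*2; first by rewrite double_gt0.
have [z hz] := C_prim_root_exists m_gt0.
have [z' hz'] := C_prim_root_exists n_gt0.
have spec_path k (t : algC) : (0 < k)%N -> k.*2.-primitive_root t ->
    spectral (fun j : path_graph k.-1 => t ^+ j.+1 + t ^- j.+1).
  by move=> k_gt0 ht; apply: spectral_path; rewrite prednK.
have big_path k (f : nat -> algC) : \prod_(j < k.-1) f j.+1 = \prod_(1 <= i < k) f i.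
  by rewrite big_add1 big_mkord.
split; apply: (@intr_inj algC).
- rewrite (det_cart_prod (spec_path _ _ m_gt0 hw) (spec_path _ _ n_gt0 hw')).
  rewrite (big_path _ (fun i => \prod_(j < n.-1)
    (w ^+ i + w ^- i + (w' ^+ j.+1 + w' ^- j.+1)))).
  under eq_bigr do rewrite (big_path _ (fun j => _ + (w' ^+ j + w' ^- j))).
  rewrite (prod_path_path hw hw').
  by case: ifP => _; rewrite ?rmorphXn ?rmorphN ?rmorph1.
- rewrite (det_cart_prod (spectral_cycle hz) (spectral_cycle hz')).
  rewrite -(big_mkord xpredT (fun i => \prod_(j < n)
    (z ^+ i + z ^- i + (z' ^+ j + z' ^- j)))).
  under eq_bigr do rewrite -(big_mkord xpredT (fun j => _ + (z' ^+ j + z' ^- j))).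
  rewrite (prod_cycle_cycle hz hz').
  by case: ifP => _; rewrite ?rmorphXn.
rewrite (det_cart_prod (spec_path _ _ m_gt0 hw) (spectral_cycle hz')).
rewrite (big_path _ (fun i => \prod_(j < n)
    (w ^+ i + w ^- i + (z' ^+ j + z' ^- j)))).
under eq_bigr do rewrite -(big_mkord xpredT (fun j => _ + (z' ^+ j + z' ^- j))).
rewrite (prod_path_cycle hw hz').
case: ifP => _; [|case: ifP => _];
  by rewrite ?rmorphM ?rmorphXn ?rmorphN ?rmorph1 ?rmorph_nat.
Qed.
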